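(* Let $m,n\in\mathbb{N}$ with $m,n\ge 2$. The set $C_1:=\{X\in\mathbb{R}^{m\times n} : \operatorname{rank}(X)\le 1\}$ of $m\times n$ real matrices of rank at most $1$ is strongly nonconvex and therefore not MICP representable.
   Context: $\mathbb{N}=\{0,1,2,\dots\}$; $\mathbb{R}^{m\times n}$ is identified with $\mathbb{R}^{mn}$. A set $S\subseteq\mathbb{R}^N$ is strongly nonconvex if there exists an infinite subset $R\subseteq S$ such that for all pairs of distinct points $x,y\in R$, $\frac{x+y}{2}\notin S$. A set $S\subseteq\mathbb{R}^N$ is MICP representable if there exist $p,d\in\mathbb{N}$ and a closed convex set $M\subseteq\mathbb{R}^{N+p+d}$, with variables $(x,y,z)\in\mathbb{R}^N\times\mathbb{R}^p\times\mathbb{R}^d$, such that $S=\{x\in\mathbb{R}^N : \exists y\in\mathbb{R}^p,\ \exists z\in\mathbb{Z}^d,\ (x,y,z)\in M\}$. *)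

(* Defs.v *)
From HB Require Import structures.
From mathcomp Require Import all_boot all_order all_algebra.
From mathcomp Require Import all_classical all_reals all_analysis.

Set Implicit Arguments.
Unset Strict Implicit.
Unset Printing Implicit Defensive.

Import Order.TTheory GRing.Theory Num.Theory.
Import numFieldNormedType.Exports.

Local Open Scope classical_set_scope.
Local Open Scope ring_scope.

Definition strongly_nonconvex (R : realType) (N : nat) (S : set 'rV[R]_N) :=
  exists2 Q : set 'rV[R]_N, Q `<=` S & infinite_set Q /\
    forall x y, Q x -> Q y -> x <> y -> ~ S (2^-1 *: (x + y)).

(* The ascription to [convex_lmodType] selects the convex-space structure
   given by the usual convex combinations of vectors. *)
Definition closed_convex (R : realType) (k : nat) (M : set 'rV[R]_k) :=
  closed M /\ convex_set (M : set (convex_lmodType 'rV[R]_k)).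

(* A point (x, y, z) of R^(N + p + d) is the concatenated row vector;
   [map_mx intr] embeds Z^d into R^d. *)
Definition MICP_representable (R : realType) (N : nat) (S : set 'rV[R]_N) :=
  exists (p d : nat) (M : set 'rV[R]_(N + p + d)),
    closed_convex M /\
    S = [set x | exists (y : 'rV[R]_p) (z : 'rV[int]_d),
                   M (row_mx (row_mx x y) (map_mx intr z))].

Definition rank_le1_matrices (R : realType) (m n : nat) : set 'M[R]_(m, n) :=
  [set X | (\rank X <= 1)%N].
Arguments rank_le1_matrices : clear implicits.

(* [mxvec] is the row-major linear isomorphism of R^(m x n) with R^(m n). *)
Definition rank_le1_vectors (R : realType) (m n : nat) : set 'rV[R]_(m * n) :=
  [set mxvec X | X in rank_le1_matrices R m n].
Arguments rank_le1_vectors : clear implicits.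

(* Main.v *)
Require Import Defs.
From HB Require Import structures.
From mathcomp Require Import all_boot all_order all_algebra.
From mathcomp Require Import all_classical all_reals all_analysis.
From mathcomp Require Import ring zify.

(** Among infinitely many points of a representable set, two have integer
    witnesses agreeing modulo 2; the average of these witnesses is again
    integral, so by convexity the midpoint is in the set. Hence a strongly
    nonconvex set is not representable. For matrices of rank at most one,
    take the m x n matrices with entries [t^(i+j)], [t = 0, 1, 2, ...] : the
    sum of those for [s] and [t] has leading 2 x 2 minor [(s - t)^2]. *)

Set Implicit Arguments.
Unset Strict Implicit.
Unset Printing Implicit Defensive.

Import Order.TTheory GRing.Theory Num.Theory.

Local Open Scope classical_set_scope.
Local Open Scope ring_scope.

(** Pigeonhole: without a collision, [f] would embed [Q] into a finite type. *)
Lemma infinite_set_collision (T : Type) (F : finType) (Q : set T) (f : T -> F) :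
  infinite_set Q -> exists x y, [/\ Q x, Q y, x <> y & f x = f y].
Proof.
apply: contra_notP => noxy.
have injf : set_inj Q f.
  move=> x y /set_mem Qx /set_mem Qy fxy; apply: contrapT => xy.
  by apply: noxy; exists x, y.
by rewrite -(eq_finite_set (inj_card_eq injf)); exact: finite_finset.
Qed.

Lemma convex_set_midpoint (R : realType) (k : nat) (M : set 'rV[R]_k) x y :
  convex_set (M : set (convex_lmodType 'rV[R]_k)) ->
  M x -> M y -> M (2^-1 *: (x + y)).
Proof.
move=> cM Mx My.
have h0 : 0 <= 2^-1 :> R by rewrite invr_ge0.
have h1 : 2^-1 <= 1 :> R by rewrite invf_le1 ?ltr0n// ler1n.
have /set_mem := cM x y (Itv01 h0 h1) (mem_set Mx) (mem_set My).
suff -> : 2^-1 *: (x + y) = 2^-1 *: x + (1 - 2^-1) *: y by [].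
by rewrite scalerDr; congr (_ + _ *: _); field.
Qed.

Lemma midpoint_int_vectors (R : realType) (d : nat) (z w : 'rV[int]_d) :
  (forall j, odd `|z 0 j| = odd `|w 0 j|) ->
  exists v : 'rV[int]_d,
    map_mx intr v = 2^-1 *: (map_mx intr z + map_mx intr w) :> 'rV[R]_d.
Proof.
move=> zw; exists (\row_j divz (z 0 j + w 0 j) 2).
apply/rowP => j; rewrite !mxE -intrD.
(* Equal parities make the sum even, so the division by 2 is exact. *)
have zwE : z 0 j + w 0 j = divz (z 0 j + w 0 j) 2 * 2.
  by have := zw j; lia.
by rewrite {2}zwE intrM mulrCA mulVf ?mulr1// pnatr_eq0.
Qed.

Lemma strongly_nonconvex_not_MICP (R : realType) (N : nat) (S : set 'rV[R]_N) :
  strongly_nonconvex S -> ~ MICP_representable S.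
Proof.
move=> [Q QS [infQ midQ]] [p [d [M [[_ cM] SE]]]].
have /choice[yz yzP] x : exists yz : 'rV[R]_p * 'rV[int]_d,
    S x -> M (row_mx (row_mx x yz.1) (map_mx intr yz.2)).
  (* Outside [S] the implication is vacuous, and [(0, 0)] is a dummy value. *)
  have [|nSx] := pselect (S x); last by exists (0, 0).
  by rewrite {1}SE => -[y [z Mxyz]]; exists (y, z).
(* Only the integer witness is classified; the real part can be averaged freely. *)
pose parity x : {ffun 'I_d -> bool} := [ffun j => odd `|(yz x).2 0 j|].
have [x [x' [Qx Qx' xx' eq_par]]] := infinite_set_collision parity infQ.
have [|v vE] := @midpoint_int_vectors R d (yz x).2 (yz x').2.
  by move=> j; have /ffunP/(_ j) := eq_par; rewrite !ffunE.
apply: (midQ x x') => //.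
rewrite SE; exists (2^-1 *: ((yz x).1 + (yz x').1)), v; rewrite vE.
rewrite -!scale_row_mx -!add_row_mx.
by apply: convex_set_midpoint => //; apply: yzP; apply: QS.
Qed.

(** [X] factors through dimension [\rank X]: in rank 1 its entries are products [C i 0 * D 0 j], so
    swapping column indices changes nothing; in rank 0 they vanish. *)
Lemma rank_le1_minor (F : fieldType) (m n : nat) (X : 'M[F]_(m, n)) i j k l :
  (\rank X <= 1)%N -> X i j * X k l = X i l * X k j.
Proof.
rewrite -{2 3 4 5}(mulmx_base X).
move: (col_base X) (row_base X); case: (\rank X) => [|[|//]] C D _.
  by rewrite !mxE !big_ord0 !mul0r.
by rewrite !mxE !big_ord1 mulrACA [in RHS]mulrACA [D _ l * _]mulrC.
Qed.

(** The Hankel moment matrix of the unit point mass at [t]. *)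
Definition moment_mx (F : fieldType) (m n : nat) (t : F) : 'M[F]_(m, n) :=
  \matrix_(i, j) t ^+ (i + j).

Lemma rank_moment_mx (F : fieldType) (m n : nat) (t : F) :
  (\rank (moment_mx m n t) <= 1)%N.
Proof.
have -> : moment_mx m n t =
    (\col_i t ^+ i : 'cV_m) *m (\row_j t ^+ j : 'rV_n).
  by apply/matrixP => i j; rewrite !mxE big_ord1 !mxE exprD.
exact: mulmx_max_rank.
Qed.

Lemma rank_moment_mx_midpoint (F : fieldType) (m n : nat) (c s t : F) :
  c != 0 ->
  (\rank (c *: (moment_mx m.+2 n.+2 s + moment_mx m.+2 n.+2 t)) <= 1)%N -> s = t.
Proof.
move=> c0 /(rank_le1_minor 0 0 1 1); rewrite !mxE /=.
rewrite ?(addn0, add0n, addn1) !expr0 !expr1 => minor0.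
have : (c * (s - t)) ^+ 2 = 0.
  (* Writing 0 as the difference of the sides of [minor0] leaves [ring] with 2(s^2 + t^2) - (s +
     t)^2 = (s - t)^2, scaled by c^2. *)
  by rewrite -(subrr (c * (s + t) * (c * (s + t)))) -{1}minor0; ring.
by move/eqP; rewrite sqrf_eq0 mulf_eq0 (negPf c0) subr_eq0 => /eqP.
Qed.

Lemma strongly_nonconvex_rank_le1 (R : realType) (m n : nat) :
  strongly_nonconvex (rank_le1_vectors R m.+2 n.+2).
Proof.
pose f (k : nat) : 'rV[R]_(m.+2 * n.+2) := mxvec (moment_mx m.+2 n.+2 k%:R).
exists (range f).
  by move=> _ [k _ <-]; exists (moment_mx _ _ k%:R); [exact: rank_moment_mx|].
split.
  rewrite (eq_finite_set (inj_card_eq _)); first exact: infinite_nat.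
  (* The entry at (0, 1) is the parameter itself, so [f] is injective. *)
  move=> k l _ _ /(can_inj mxvecK)/matrixP/(_ 0 1).
  by rewrite !mxE /= !expr1 => /eqP; rewrite eqr_nat => /eqP.
move=> _ _ [k _ <-] [l _ <-] kl [X rX XE]; apply: kl; congr f.
apply/eqP; rewrite -(eqr_nat R); apply/eqP.
have c0 : 2^-1 != 0 :> R by rewrite invr_eq0 pnatr_eq0.
apply: (@rank_moment_mx_midpoint R m n 2^-1) => //.
suff <- : X = 2^-1 *: (moment_mx _ _ k%:R + moment_mx _ _ l%:R) by [].
by apply: (can_inj mxvecK); rewrite XE linearZ; congr (_ *: _); rewrite linearD.
Qed.

Theorem proposition3 (R : realType) (m n : nat) (hm : (2 <= m)%N) (hn : (2 <= n)%N) :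
  strongly_nonconvex (rank_le1_vectors R m n) /\
  ~ MICP_representable (rank_le1_vectors R m n).
Proof.
case: m n hm hn => [|[|m]] // [|[|n]] // _ _.
have snc := @strongly_nonconvex_rank_le1 R m n.
by split=> //; exact: strongly_nonconvex_not_MICP.
Qed.
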